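(* Let $G$ be a discrete Abelian group with neutral element $0$, and let $\Omega\subseteq G$ be a symmetric set ($\Omega=-\Omega$) with $0\in\Omega$. Let $\rho,\sigma\in \ell^\infty(G;\mathbb{R})$, where $\sigma$ is strictly positive definite and $\rho$ is even. Let \[ \mathcal{F}_G^\sigma(\Omega):=\{ f\in \ell^1(G;\mathbb{R}) : f \text{ positive definite},\ f|_{G\setminus\Omega}\le 0,\ \langle f,\sigma\rangle=1\}, \] and, for $\Theta\subseteq G$, \[ \mathcal{M}_G(\Theta):=\{\mu\in \ell^\infty(G;\mathbb{R}) : \mu=\nu-\kappa,\ \kappa\ge 0,\ \kappa|_{G\setminus\Theta}=0,\ \nu \text{ positive definite}\}. \] Then to the ''primal'' linear programming extremal problem \[ \alpha_\sigma^\rho(\Omega):=\inf\{\langle f,\rho\rangle : f\in \mathcal{F}_G^\sigma(\Omega)\} \] the corresponding dual linear programming problem is \[ \omega_\sigma^\rho(G\setminus\Omega):=\sup\{ s\in\mathbb{R} : \rho-s\sigma\in \mathcal{M}_G(G\setminus\Omega)\}, \] and there is no duality gap between the two problems, i.e. $\alpha_\sigma^\rho(\Omega)=\omega_\sigma^\rho(G\setminus\Omega)$.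
   Context: $\ell^1(G;\mathbb{R})$ is the Banach space of real-valued summable functions on $G$; its topological dual is identified with $\ell^\infty(G;\mathbb{R})$, the real-valued bounded functions, through $\langle f,\varphi\rangle=\sum_{g\in G} f(g)\varphi(g)$. A function $f:G\to\mathbb{C}$ is positive definite if $\sum_{k=1}^n\sum_{l=1}^n c_k\overline{c_l}\,f(x_k-x_l)\ge 0$ for all $n\in\mathbb{N}$, $c_1,\dots,c_n\in\mathbb{C}$, $x_1,\dots,x_n\in G$. A function $\varphi$ is even if $\varphi(-g)=\varphi(g)$ for all $g\in G$. A functional $\sigma\in\ell^\infty(G;\mathbb{R})$ is strictly positive definite if $\sigma$ is a positive definite function and $\langle f,\sigma\rangle>0$ for every nonzero positive definite $f\in\ell^1(G;\mathbb{R})$. Conventions: $\inf\emptyset=\infty$, $\sup\emptyset=-\infty$; infima and suprema are taken in $[-\infty,\infty]$. *)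

(* Defs.v *)
From HB Require Import structures.
From mathcomp Require Import all_boot all_order all_algebra.
From mathcomp Require Import complex.
From mathcomp Require Import all_classical all_reals all_analysis.
Set Implicit Arguments.
Unset Strict Implicit.
Unset Printing Implicit Defensive.
Import Order.TTheory GRing.Theory Num.Theory.
Import numFieldNormedType.Exports.
Local Open Scope classical_set_scope.
Local Open Scope ring_scope.

Definition l1 (G : zmodType) (R : realType) : set (G -> R) :=
  [set f : G -> R | summable [set: G] (EFin \o f)].

Definition linfty (G : zmodType) (R : realType) : set (G -> R) :=
  [set phi : G -> R | bounded_fun phi].

(* [esum] is a supremum of finite sums, hence only meaningful for nonnegative
   families: an absolutely summable signed family is summed as the difference
   of the sums of its positive and negative parts. *)
Definition pairing (G : zmodType) (R : realType) (f phi : G -> R) : R :=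
  let h : G -> \bar R := fun g => (f g * phi g)%:E in
  fine (esum [set: G] h^\+ - esum [set: G] h^\-)%E.

(* In [R[i]], [0 <= z] says that [z] is real and nonnegative. *)
Definition positive_definite (G : zmodType) (R : realType) (f : G -> R[i]) :
    Prop :=
  forall (n : nat) (c : 'I_n -> R[i]) (x : 'I_n -> G),
    0 <= \sum_(k < n) \sum_(l < n) c k * ((c l)^*)%C * f (x k - x l).

Definition rpositive_definite (G : zmodType) (R : realType) (f : G -> R) :
    Prop :=
  positive_definite (fun g => (f g)%:C%C).

Definition even_function (G : zmodType) (R : realType) (phi : G -> R) : Prop :=
  forall g, phi (- g) = phi g.

Definition strictly_positive_definite (G : zmodType) (R : realType)
    (sigma : G -> R) : Prop :=
  [/\ linfty sigma, rpositive_definite sigma &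
      forall f : G -> R, l1 f -> rpositive_definite f -> f <> cst 0 ->
        0 < pairing f sigma].

Definition primal_cone (G : zmodType) (R : realType) (Omega : set G) :
    set (G -> R) :=
  [set f : G -> R | [/\ l1 f, rpositive_definite f &
               forall g, (~` Omega) g -> f g <= 0]].

Definition F_class (G : zmodType) (R : realType) (sigma : G -> R)
    (Omega : set G) : set (G -> R) :=
  [set f : G -> R | [/\ l1 f, rpositive_definite f,
               forall g, (~` Omega) g -> f g <= 0 & pairing f sigma = 1]].

(* As mu and kappa are real-valued, so is nu = mu + kappa. *)
Definition M_class (G : zmodType) (R : realType) (Theta : set G) :
    set (G -> R) :=
  [set mu : G -> R | linfty mu /\
    exists nu kappa : G -> R,
      [/\ mu = nu \- kappa, forall g, 0 <= kappa g,
          forall g, (~` Theta) g -> kappa g = 0 & rpositive_definite nu]].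

Definition alpha (G : zmodType) (R : realType) (rho sigma : G -> R)
    (Omega : set G) : \bar R :=
  ereal_inf [set (pairing f rho)%:E | f in F_class sigma Omega].

Definition omega (G : zmodType) (R : realType) (rho sigma : G -> R)
    (Theta : set G) : \bar R :=
  ereal_sup [set s%:E | s in [set s : R |
    M_class Theta (fun g => rho g - s * sigma g)]].

(* Linear programming duality for the pair (l^1(G), l^oo(G)): for a convex cone
   K in l^1(G), the program
     minimise <f, c>  subject to  f \in K and <f, a> = 1
   has Lagrangian  <f, c> - s (<f, a> - 1) = s + <f, c - s a>,  f \in K, s real.
   Its dual is therefore
     maximise s  subject to  c - s a \in K^*,
   where K^* is the dual cone of K. *)
Definition dual_cone (G : zmodType) (R : realType) (K : set (G -> R)) :
    set (G -> R) :=
  [set mu : G -> R | linfty mu /\ forall f, K f -> 0 <= pairing f mu].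

Definition lp_feasible (G : zmodType) (R : realType) (K : set (G -> R))
    (a : G -> R) : set (G -> R) :=
  [set f : G -> R | K f /\ pairing f a = 1].

Definition dual_lp_feasible (G : zmodType) (R : realType) (K : set (G -> R))
    (c a : G -> R) : set R :=
  [set s | dual_cone K (fun g => c g - s * a g)].

(* Main.v *)
Require Import Defs.
From HB Require Import structures.
From mathcomp Require Import all_boot all_order all_algebra.
From mathcomp Require Import finmap complex.
From mathcomp Require Import all_classical all_reals all_analysis.
From mathcomp Require Import ring lra zify.
Set Implicit Arguments.
Unset Strict Implicit.
Unset Printing Implicit Defensive.
Import Order.TTheory GRing.Theory Num.Theory.
Import numFieldNormedType.Exports.
Local Open Scope classical_set_scope.
Local Open Scope ring_scope.

(* Everything reduces to the equality of the dual of the primal cone with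
   [M_class (~` Omega)]; then there is no gap, because a real [s <= alpha] is
   dual feasible: a nonzero [f] of the primal cone has [pairing f sigma > 0] and
   can be rescaled into [F_class].

   One inclusion says that [pairing f nu >= 0] for positive definite [f] in l^1
   and positive definite [nu].  By the Schur product theorem [h = f nu] is
   positive definite, and its sum is the limit of the averages of [h (x - y)]
   over [x, y] in Folner sets, which exist because the sets of combinations
   [\sum_i m_i s_i], [m_i <= N], grow polynomially in [N].

   For the other, let [mu] be even, bounded and nonnegative on the primal cone.
   On a finite symmetric [S], take a positive definite [nu] that minimises the
   squared distance to the functions equal to [mu] on [Omega] and at least [mu]
   off [Omega]; it exists by Tychonoff's theorem, as [|nu| <= nu 0].  First
   order optimality makes the residual [f], extended by zero, nonnegative on
   positive definite functions, hence positive definite; so [f] is in the primal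
   cone.  But [pairing f mu] is at most minus the squared distance, which is
   therefore zero.  Compactness removes the restriction to finite [S], and
   [kappa = nu - mu]. *)

(** * Unconditional sums of real families *)

Section UnconditionalSum.
Variables (T : choiceType) (R : realType).
Implicit Types (h k f phi : T -> R) (A B : {fset T}) (l m : R).

(** Limit of the net of finite partial sums. Linearity and uniqueness of this limit replace
    computations with the positive and negative parts in [pairing]. *)
Definition has_sum h l := forall e : R, 0 < e ->
  exists A, forall B, (A `<=` B)%fset -> `|l - \sum_(g <- B) h g| <= e.

Lemma sum_fsetID A B h : (A `<=` B)%fset ->
  \sum_(g <- B) h g = \sum_(g <- A) h g + \sum_(g <- (B `\` A)%fset) h g.
Proof.
move=> AB; rewrite (big_fsetID _ (mem A)) /=; congr (_ + _).
  apply: eq_fbig => // g; rewrite !inE /=; apply/andP/idP => [[]//|gA].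
  by split=> //; exact: (fsubsetP AB).
by apply: eq_fbig => // g; rewrite !inE /= andbC.
Qed.

Lemma ler_sum_fset A B h : (A `<=` B)%fset -> (forall g, 0 <= h g) ->
  \sum_(g <- A) h g <= \sum_(g <- B) h g.
Proof. by move=> AB h0; rewrite (sum_fsetID _ AB) lerDl sumr_ge0. Qed.

Lemma has_sum_unique h l m : has_sum h l -> has_sum h m -> l = m.
Proof.
move=> hl hm; apply/eqP/negPn/negP => lm.
have e0 : 0 < `|l - m| / 3 by rewrite divr_gt0 ?normr_gt0 ?subr_eq0.
have [A hA] := hl _ e0; have [B hB] := hm _ e0.
have := hA (A `|` B)%fset (fsubsetUl _ _).
have := hB (A `|` B)%fset (fsubsetUr _ _).
set s := \sum_(g <- _) _ => ms ls.
have := ler_normD (l - s) (s - m).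
rewrite addrA subrK (distrC s) => lsm.
by lra.
Qed.

Lemma has_sumD h k l m : has_sum h l -> has_sum k m -> has_sum (h \+ k) (l + m).
Proof.
move=> hl km e e0; have e2 : 0 < e / 2 by lra.
have [A hA] := hl _ e2; have [B hB] := km _ e2.
exists (A `|` B)%fset => C ABC.
have /hA lC : (A `<=` C)%fset by exact: fsubset_trans (fsubsetUl _ _) ABC.
have /hB mC : (B `<=` C)%fset by exact: fsubset_trans (fsubsetUr _ _) ABC.
rewrite big_split /= opprD addrACA (le_trans (ler_normD _ _))//.
by lra.
Qed.

Lemma has_sumZ h l (a : R) : has_sum h l -> has_sum (fun g => a * h g) (a * l).
Proof.
move=> hl e e0; have e1 : 0 < e / (`|a| + 1) by rewrite divr_gt0 ?ltr_wpDl.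
have [A hA] := hl _ e1; exists A => B /hA lB.
rewrite -mulr_sumr -mulrBr normrM.
rewrite (le_trans (ler_wpM2l _ lB)) ?normr_ge0// mulrCA ler_piMr ?(ltW e0)//.
by rewrite ler_pdivrMr ?ltr_wpDl// mul1r lerDl.
Qed.

Lemma has_sumB h k l m : has_sum h l -> has_sum k m -> has_sum (h \- k) (l - m).
Proof.
move=> hl /has_sumZ - /(_ (-1)) km; rewrite -mulN1r.
rewrite (_ : h \- k = h \+ (fun g => -1 * k g)); first exact: has_sumD.
by apply/funext => g /=; rewrite mulN1r.
Qed.

Lemma has_sum_ge0 h l : (forall g, 0 <= h g) -> has_sum h l -> 0 <= l.
Proof.
move=> h0 hl; apply/ler_addgt0Pr => e e0; have [A hA] := hl _ e0.
have := hA A (fsubset_refl _); rewrite ler_norml => /andP[+ _].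
by have : 0 <= \sum_(g <- A) h g by [exact: sumr_ge0]; lra.
Qed.

Lemma has_sum_fset A h : (forall g, g \notin A -> h g = 0) ->
  has_sum h (\sum_(g <- A) h g).
Proof.
move=> h0 e e0; exists A => B AB.
by rewrite (big_fset_incl _ AB) ?subrr ?normr0 ?(ltW e0)// => g _ /h0.
Qed.

(** Cauchy criterion: the sums over [A] and over the union of [A] and [B] are both within [e / 2] of
    [l]. *)
Lemma has_sum_tail h l : has_sum h l -> (forall g, 0 <= h g) ->
  forall e : R, 0 < e -> exists A, forall B, [disjoint A & B]%fset ->
  \sum_(g <- B) h g <= e.
Proof.
move=> hl h0 e e0; have e2 : 0 < e / 2 by lra.
have [A hA] := hl _ e2; exists A => B AB.
have := hA A (fsubset_refl _).
have := hA (A `|` B)%fset (fsubsetUl _ _).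
rewrite (sum_fsetID _ (fsubsetUl A B)).
have -> : ((A `|` B) `\` A = B)%fset.
  by rewrite fsetDUl fsetDv fset0U; apply/fsetDidPl; rewrite fdisjoint_sym.
rewrite !ler_norml => /andP[? ?] /andP[? ?]; lra.
Qed.

Lemma esum_has_sum h : (forall g, 0 <= h g) ->
  (esum [set: T] (fun g => (h g)%:E) < +oo)%E ->
  has_sum h (fine (esum [set: T] (fun g => (h g)%:E))).
Proof.
move=> h0 hoo.
have hfin : esum [set: T] (fun g => (h g)%:E) \is a fin_num.
  by rewrite ge0_fin_numE// esum_ge0// => g _; rewrite lee_fin.
have sumE (X : set T) : finite_set X ->
    (\sum_(x \in X) (h x)%:E)%R = (\sum_(g <- fset_set X) h g)%:E.
  by move=> fX; rewrite fsbig_finite// sumEFin.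
move=> e e0.
have [_ [X [fX _] <-]] := ub_ereal_sup_adherent e0 hfin.
rewrite sumE// -/(esum _ _) -(fineK hfin) -EFinB lte_fin => ltX.
exists (fset_set X) => B /ler_sum_fset -/(_ _ h0) leXB.
have leB : \sum_(g <- B) h g <= fine (esum [set: T] (fun g => (h g)%:E)).
  rewrite -lee_fin fineK//; apply: esum_ge; exists [set` B].
    by split; [exact: finite_fset|].
  by rewrite sumE ?set_fsetK//; exact: finite_fset.
by rewrite ger0_norm ?subr_ge0//; lra.
Qed.

End UnconditionalSum.

(** * The pairing of l^1 with l^oo as an unconditional sum *)

Section Pairing.
Variables (G : zmodType) (R : realType).
Implicit Types (f phi : G -> R).

Lemma linfty_bound phi : linfty phi -> exists2 M, 0 < M & forall g, `|phi g| <= M.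
Proof.
move=> [M [_ hM]]; exists (`|M| + 1); first by rewrite ltr_wpDl.
by move=> g; apply: hM => //; rewrite (le_lt_trans (ler_norm M))// ltrDl.
Qed.

Lemma bound_linfty phi M : (forall g, `|phi g| <= M) -> linfty phi.
Proof.
move=> hM; exists M; split=> [|x Mx g _]; first exact: num_real.
exact: le_trans (hM g) (ltW Mx).
Qed.

Lemma linftyB phi psi (s : R) : linfty phi -> linfty psi ->
  linfty (fun g => phi g - s * psi g).
Proof.
move=> /linfty_bound[M1 _ hM1] /linfty_bound[M2 _ hM2].
apply: (@bound_linfty _ (M1 + `|s| * M2)) => g.
by rewrite (le_trans (ler_normB _ _))// lerD// normrM ler_wpM2l.
Qed.

Lemma esum_mul_lt_pinfty f phi : l1 f -> linfty phi ->
  (esum [set: G] (fun g => `|f g * phi g|%:E) < +oo)%E.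
Proof.
rewrite /l1/= /summable/= => f1 /linfty_bound[M M0 hM].
have hsf := @esum_has_sum _ _ (fun g => `|f g|) (fun g => normr_ge0 (f g)) f1.
have := has_sumZ M hsf; set l := fine _ => hl.
(* The [+ 1] is the tolerance at which [has_sum] is applied below; any finite bound will do. *)
apply: (@le_lt_trans _ _ (M * l + 1)%:E); last exact: ltry.
apply: ge_ereal_sup => _ [X [fX _] <-].
rewrite fsbig_finite// sumEFin lee_fin.
have [A hA] := hl _ (@ltr01 R).
apply: (@le_trans _ _ (\sum_(g <- (A `|` fset_set X)%fset) M * `|f g|)).
  apply: (@le_trans _ _ (\sum_(g <- fset_set X) M * `|f g|)).
    by apply: ler_sum => g _; rewrite normrM mulrC ler_wpM2r.
  by apply: ler_sum_fset => [|g]; [exact: fsubsetUr|rewrite mulr_ge0// ltW].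
have := hA _ (fsubsetUl A (fset_set X)).
by rewrite ler_norml => /andP[+ _]; lra.
Qed.

Lemma abs_has_sum f phi : l1 f -> linfty phi ->
  exists l, has_sum (fun g => `|f g * phi g|) l.
Proof.
move=> fl phil; eexists; apply: esum_has_sum => //.
exact: esum_mul_lt_pinfty.
Qed.

(** Both parts [p] and [m] of the product have finite [esum], so [fine] commutes with the difference
    and the two nonnegative sums can be subtracted. *)
Lemma pairing_has_sum f phi : l1 f -> linfty phi ->
  has_sum (fun g => f g * phi g) (pairing f phi).
Proof.
move=> fl phil; rewrite /pairing.
set h := fun g => (f g * phi g)%:E.
have hoo : summable [set: G] h by exact: esum_mul_lt_pinfty.
have hp := summable_funepos hoo; have hm := summable_funeneg hoo.
pose p g := Num.max (f g * phi g) 0; pose m g := Num.max (- (f g * phi g)) 0.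
have hpE : h^\+%E = fun g => (p g)%:E.
  by apply/funext => g; rewrite funeposE /h -EFin_max.
have hmE : h^\-%E = fun g => (m g)%:E.
  by apply/funext => g; rewrite funenegE /h -EFinN -EFin_max.
have p0 g : 0 <= p g by rewrite le_max lexx orbT.
have m0 g : 0 <= m g by rewrite le_max lexx orbT.
have pE : (esum [set: G] (fun g => (p g)%:E) < +oo)%E.
  by apply: le_lt_trans hp; apply: le_esum => g _; rewrite hpE lee_fin ler_norm.
have mE : (esum [set: G] (fun g => (m g)%:E) < +oo)%E.
  by apply: le_lt_trans hm; apply: le_esum => g _; rewrite hmE lee_fin ler_norm.
rewrite hpE hmE fineB; last 2 first.
- by rewrite ge0_fin_numE// esum_ge0// => g _; rewrite lee_fin.
- by rewrite ge0_fin_numE// esum_ge0// => g _; rewrite lee_fin.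
rewrite (_ : (fun g => f g * phi g) = p \- m); last first.
  apply/funext => g; rewrite /p /m /=.
  by case: (ltP (f g * phi g) 0) => ?; case: ltP => ?; lra.
by apply: has_sumB; exact: esum_has_sum.
Qed.

Lemma pairingB f phi psi (s : R) : l1 f -> linfty phi -> linfty psi ->
  pairing f (fun g => phi g - s * psi g) = pairing f phi - s * pairing f psi.
Proof.
move=> fl phil psil.
apply: (@has_sum_unique _ _ (fun g => f g * (phi g - s * psi g))).
  by apply: pairing_has_sum => //; exact: linftyB.
rewrite (_ : (fun _ => _) =
    (fun g => f g * phi g) \- (fun g => s * (f g * psi g))); last first.
  by apply/funext => g /=; ring.
apply: has_sumB; first exact: pairing_has_sum.
exact/has_sumZ/pairing_has_sum.
Qed.

Lemma l1Z f (a : R) : l1 f -> l1 (fun g => a * f g).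
Proof.
move=> fl; have := @esum_mul_lt_pinfty f (cst a) fl.
rewrite /l1 /= /summable => foo; apply: le_lt_trans (foo _).
  by apply: le_esum => g _; rewrite /= mulrC.
by apply: (@bound_linfty _ `|a|) => g.
Qed.

Lemma pairingZl f phi (a : R) : l1 f -> linfty phi ->
  pairing (fun g => a * f g) phi = a * pairing f phi.
Proof.
move=> fl phil.
apply: (@has_sum_unique _ _ (fun g => a * f g * phi g)).
  by apply: pairing_has_sum; [exact: l1Z|].
have := has_sumZ a (pairing_has_sum fl phil).
by under eq_fun do rewrite mulrA.
Qed.

Lemma l1_fset f (A : {fset G}) : (forall g, g \notin A -> f g = 0) -> l1 f.
Proof.
move=> f0; rewrite /l1/= /summable.
apply: (@le_lt_trans _ _ (\sum_(g <- A) `|f g|)%:E); last exact: ltry.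
apply: ge_ereal_sup => _ [X [fX _] <-].
rewrite fsbig_finite//= sumEFin lee_fin.
apply: (@le_trans _ _ (\sum_(g <- (A `|` fset_set X)%fset) `|f g|)).
  by apply: ler_sum_fset => //; exact: fsubsetUr.
rewrite -(big_fset_incl _ (fsubsetUl A (fset_set X)))// => g _ /f0 ->.
by rewrite normr0.
Qed.

Lemma pairing0l phi : linfty phi -> pairing (cst 0) phi = 0.
Proof.
move=> phil.
have l0 : l1 (cst 0 : G -> R) by exact: (@l1_fset _ fset0).
apply: (has_sum_unique (pairing_has_sum l0 phil)).
have := @has_sum_fset _ _ fset0 (fun g : G => cst 0 g * phi g).
by rewrite big_seq_fset0; apply => g _; rewrite mul0r.
Qed.

End Pairing.

(** * Schur's product theorem for real matrices *)

Section PositiveSemidefiniteMatrices.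
Variable R : realType.

(** Symmetry is required separately, because a real quadratic form does not see the antisymmetric
    part of its matrix. *)
Definition psd (I : finType) (A : I -> I -> R) :=
  (forall i j, A i j = A j i) /\
  forall c : I -> R, 0 <= \sum_i \sum_j c i * c j * A i j.

Lemma sum_ord_recl2 n (F : 'I_n.+1 -> 'I_n.+1 -> R) :
  \sum_i \sum_j F i j = F ord0 ord0 + \sum_j F ord0 (lift ord0 j) +
    \sum_i F (lift ord0 i) ord0 + \sum_i \sum_j F (lift ord0 i) (lift ord0 j).
Proof.
rewrite big_ord_recl /=; under [X in _ + X]eq_bigr do rewrite big_ord_recl /=.
by rewrite big_split big_ord_recl !addrA.
Qed.

(* Induction on the size, replacing [A] by its Schur complement
   [A i j - A 0 i * A 0 j / A 0 0]; if [A 0 0 = 0] then row [0] vanishes and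
   the convention [x / 0 = 0] makes the same formula work. *)
Lemma psd_sum_mul_ord n (A B : 'I_n -> 'I_n -> R) : psd A -> psd B ->
  0 <= \sum_i \sum_j A i j * B i j.
Proof.
elim: n A B => [|n IHn] A B [sA pA] [sB pB]; first by rewrite big_ord0.
pose a := A ord0 ord0; pose v i := A ord0 (lift ord0 i).
pose A' i j := A (lift ord0 i) (lift ord0 j) - v i * v j / a.
pose Q (c : 'I_n -> R) :=
  \sum_i \sum_j c i * c j * A (lift ord0 i) (lift ord0 j).
(* The form of [A] at the vector with entry [t] at index 0 and entries [c] elsewhere, as a quadratic
   polynomial in [t]. *)
have pA' (c : 'I_n -> R) (t : R) :
    0 <= t ^+ 2 * a + t * (\sum_i c i * v i) *+ 2 + Q c.
  have := pA (fun i => if unlift ord0 i is Some j then c j else t).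
  rewrite sum_ord_recl2 /= unlift_none.
  under [X in _ + X + _ + _]eq_bigr do rewrite liftK -mulrA.
  under [X in _ + _ + X + _]eq_bigr do
    rewrite liftK sA -mulrA mulrCA.
  under [X in _ + _ + _ + X]eq_bigr do
    under eq_bigr do rewrite !liftK.
  by rewrite -!mulr_sumr -expr2 mulr2n !addrA.
have a0 : 0 <= a.
  have := pA' (fun=> 0) 1; rewrite /Q !big1.
  - by rewrite mulr0 mul0rn !addr0 expr1n mul1r.
  - by move=> i _; rewrite big1// => j _; rewrite !mul0r.
  - by move=> i _; rewrite mul0r.
have v0 : a = 0 -> forall i, v i = 0.
  move=> aE i; apply/eqP/negPn/negP => vi.
  pose c j : R := (j == i)%:R.
  have cv : \sum_j c j * v j = v i.
    rewrite (bigD1 i)//= /c eqxx mul1r big1 ?addr0// => j /negbTE ->.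
    by rewrite mul0r.
  (* For this [t] the linear term is [- (Q c + 1)], so the form would be -1. *)
  have := pA' c (- (Q c + 1) / (v i *+ 2)).
  rewrite aE mulr0 add0r cv -mulrnAr divfK ?mulrn_eq0//.
  by lra.
have QE c : \sum_i \sum_j c i * c j * A' i j =
    Q c - (\sum_i c i * v i) ^+ 2 / a.
  rewrite expr2 mulr_suml mulr_suml /Q -sumrB; apply: eq_bigr => i _.
  rewrite mulr_sumr mulr_suml -sumrB; apply: eq_bigr => j _.
  by rewrite /A'; ring.
have psdA' : psd A'.
  split=> [i j|c]; first by rewrite /A' sA; congr (_ - _); ring.
  rewrite QE; have [aE|aN] := eqVneq a 0.
    have := pA' c 0; rewrite aE invr0 !mulr0 subr0.
    by rewrite mul0r mul0rn !add0r.
  (* The minimiser in [t]; the minimum is the form of the Schur complement. *)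
  have := pA' c (- (\sum_i c i * v i) / a).
  set s := \sum_i _; congr (_ <= _); rewrite mulr2n.
  by field.
have psdB' : psd (fun i j => B (lift ord0 i) (lift ord0 j)).
  split=> [i j|c]; first exact: sB.
  have := pB (fun i => if unlift ord0 i is Some j then c j else 0).
  rewrite sum_ord_recl2 /= unlift_none.
  under [X in _ + X + _ + _]eq_bigr do rewrite !mul0r.
  under [X in _ + _ + X + _]eq_bigr do rewrite mulr0 mul0r.
  under [X in _ + _ + _ + X]eq_bigr do
    under eq_bigr do rewrite !liftK.
  by rewrite mul0r mul0r !big1_eq !add0r.
have aV x : (a = 0 -> x = 0) -> a^-1 * (a * x) = x.
  by have [->/(_ erefl)->|aN _] := eqVneq a 0; rewrite ?mulr0// mulKf.
have aw i : A ord0 i = a^-1 * (A ord0 ord0 * A ord0 i).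
  rewrite aV// => aE; have [j ->|->//] := unliftP ord0 i.
  exact: v0.
(* [A] is a rank-one matrix plus a matrix whose row and column 0 vanish. The first contributes the
   form of [B] at row 0 of [A], the second is the induction hypothesis. *)
rewrite (_ : \sum_i _ = a^-1 * (\sum_i \sum_j A ord0 i * A ord0 j * B i j) +
   \sum_i \sum_j (A i j - a^-1 * (A ord0 i * A ord0 j)) * B i j); last first.
  rewrite mulr_sumr -big_split; apply: eq_bigr => i _ /=.
  by rewrite mulr_sumr -big_split; apply: eq_bigr => j _ /=; ring.
apply: addr_ge0; first by rewrite mulr_ge0 ?invr_ge0.
rewrite sum_ord_recl2 -aw subrr mul0r add0r.
rewrite [X in X + _ + _]big1 => [|i _]; last by rewrite -aw subrr mul0r.
rewrite add0r [X in X + _]big1 => [|i _]; last first.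
  by rewrite (mulrC (A ord0 (lift _ _))) -aw sA subrr mul0r.
rewrite add0r; apply: le_trans (IHn _ _ psdA' psdB') _; apply: ler_sum => i _.
by apply: ler_sum => j _; rewrite (mulrC a^-1).
Qed.

Lemma sum_enum_val (I : finType) (F : I -> R) :
  \sum_i F i = \sum_(k < #|I|) F (enum_val k).
Proof. exact: reindex (onW_bij _ (@enum_val_bij I)). Qed.

Lemma psd_sum_mul (I : finType) (A B : I -> I -> R) : psd A -> psd B ->
  0 <= \sum_i \sum_j A i j * B i j.
Proof.
have psd_ord (D : I -> I -> R) : psd D ->
    psd (fun k l : 'I_#|I| => D (enum_val k) (enum_val l)).
  move=> [sD pD]; split=> [k l|c]; first exact: sD.
  have := pD (fun i => c (enum_rank i)); rewrite sum_enum_val.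
  by congr (_ <= _); apply: eq_bigr => k _; rewrite sum_enum_val;
     apply: eq_bigr => l _; rewrite !enum_valK.
move=> /psd_ord pA /psd_ord pB; rewrite sum_enum_val.
by under eq_bigr do rewrite sum_enum_val; exact: psd_sum_mul_ord pA pB.
Qed.

End PositiveSemidefiniteMatrices.

(** * Real positive definite functions *)

Section PositiveDefinite.
Variables (G : zmodType) (R : realType).
Implicit Types (f h nu : G -> R).

(** Real coefficients do not detect the odd part of [f], so evenness is added; with complex
    coefficients it is automatic. *)
Definition real_pd f := even_function f /\
  forall (I : finType) (c : I -> R) (x : I -> G),
    0 <= \sum_i \sum_j c i * c j * f (x i - x j).

(** With coefficients 1 and i at the points 0 and [g], the imaginary part of the form is
    [f g - f (- g)], and it must vanish. *)
Lemma rpositive_definite_even f : rpositive_definite f -> even_function f.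
Proof.
move=> fpd g.
have := fpd 2%N (fun i => if i == ord0 then 1 else 'i%C)
  (fun i => if i == ord0 then 0 else g).
rewrite !big_ord_recl !big_ord0 /= !subrr !sub0r !subr0 !addr0.
rewrite -[1]/(1 +i* 0)%C -[0]/(0 +i* 0)%C; simpc.
by move=> /andP[/eqP fg _]; lra.
Qed.

(** For [c = a + i b] the real part of the form is the sum of the forms at [a] and at [b]; the
    imaginary part changes sign when the two indices are swapped. *)
Lemma rpositive_definiteP f : rpositive_definite f <-> real_pd f.
Proof.
split=> [fpd|[fe fpd] n c x].
  split=> [|I c x]; first exact: rpositive_definite_even.
  have := fpd #|I| (fun k => (c (enum_val k))%:C%C) (fun k => x (enum_val k)).
  rewrite -ler0c; congr (_ <= _); rewrite sum_enum_val rmorph_sum.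
  apply: eq_bigr => k _; rewrite sum_enum_val rmorph_sum.
  by apply: eq_bigr => l _; rewrite conjc_real !rmorphM.
pose a k := complex.Re (c k); pose b k := complex.Im (c k).
have termE k l : c k * ((c l)^*)%C * (f (x k - x l))%:C%C =
  ((a k * a l + b k * b l) * f (x k - x l) +i*
   ((b k * a l - a k * b l) * f (x k - x l)))%C.
  rewrite /a /b; case: (c k) => ? ?; case: (c l) => ? ?; simpc => /=.
  by congr Complex; ring.
have sumC (F H : 'I_n -> R) :
    \sum_i (F i +i* H i)%C = ((\sum_i F i) +i* (\sum_i H i))%C.
  by elim/big_rec3: _ => // i u v w _ ->; simpc.
under eq_bigr => k _ do (under eq_bigr => l _ do rewrite termE; rewrite sumC).
rewrite sumC lecE /=; apply/andP; split.
  set S := \sum_k _; suff : S = - S by move=> ?; apply/eqP; lra.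
  rewrite {1}/S exchange_big -sumrN; apply: eq_bigr => k _.
  rewrite -sumrN; apply: eq_bigr => l _.
  by rewrite -opprB fe; ring.
under eq_bigr do (under eq_bigr do rewrite mulrDl; rewrite big_split).
by rewrite big_split addr_ge0.
Qed.

(** Coefficients 1 and [c] at the points 0 and [g], with [c] equal to 1 and -1. *)
Lemma real_pd_le f g : real_pd f -> `|f g| <= f 0.
Proof.
move=> [fe fpd].
have fg (c : R) : 0 <= (1 + c ^+ 2) * f 0 + c * f g *+ 2.
  have := fpd 'I_2 (fun i => if i == ord0 then 1 else c)
    (fun i => if i == ord0 then 0 else g).
  rewrite !big_ord_recl !big_ord0 /= !subrr !sub0r !subr0 !addr0 fe.
  by congr (_ <= _); ring.
by have := fg 1; have := fg (-1); rewrite ler_norml; lra.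
Qed.

Lemma real_pdM f h : real_pd f -> real_pd h -> real_pd (fun g => f g * h g).
Proof.
move=> [fe fpd] [he hpd]; split=> [g|I c x]; first by rewrite fe he.
(* The coefficients are absorbed into the first matrix, so that [psd_sum_mul] yields the whole form
   of the product. *)
have pA : psd (fun i j : I => c i * c j * f (x i - x j)).
  split=> [i j|d]; first by rewrite -[in RHS]opprB fe (mulrC (c i)).
  have := fpd I (fun i => d i * c i) x; congr (_ <= _).
  by apply: eq_bigr => i _; apply: eq_bigr => j _; ring.
have pB : psd (fun i j : I => h (x i - x j)).
  by split=> [i j|d]; [rewrite -[in RHS]opprB he|exact: hpd].
have := psd_sum_mul pA pB; congr (_ <= _).
by apply: eq_bigr => i _; apply: eq_bigr => j _; ring.
Qed.

Lemma real_pdZ f (a : R) : 0 <= a -> real_pd f -> real_pd (fun g => a * f g).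
Proof.
move=> a0 [fe fpd]; split=> [g|I c x]; first by rewrite fe.
have := mulr_ge0 a0 (fpd I c x); rewrite mulr_sumr; congr (_ <= _).
by apply: eq_bigr => i _; rewrite mulr_sumr; apply: eq_bigr => j _; ring.
Qed.

Lemma real_pdD f h : real_pd f -> real_pd h -> real_pd (fun g => f g + h g).
Proof.
move=> [fe fpd] [he hpd]; split=> [g|I c x]; first by rewrite fe he.
have := addr_ge0 (fpd I c x) (hpd I c x); rewrite -big_split; congr (_ <= _).
by apply: eq_bigr => i _; rewrite -big_split; apply: eq_bigr => j _ /=; ring.
Qed.

Lemma real_pd0 : real_pd (fun=> 0).
Proof.
split=> // I c x; rewrite sumr_ge0// => i _; rewrite sumr_ge0// => j _.
by rewrite mulr0.
Qed.

Lemma real_pd_delta : real_pd (fun g => (g == 0)%:R).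
Proof.
split=> [g|I c x]; first by rewrite oppr_eq0.
pose s := undup (codom x).
(* Grouping the indices by the value of [x] turns the form into a sum of squares. *)
rewrite (_ : \sum_i _ = \sum_(z <- s) (\sum_i c i * (x i == z)%:R) ^+ 2).
  by apply: sumr_ge0 => z _; exact: sqr_ge0.
under [RHS]eq_bigr do rewrite expr2 mulr_suml.
rewrite [RHS]exchange_big; apply: eq_bigr => i _.
under [RHS]eq_bigr do rewrite mulr_sumr.
rewrite [RHS]exchange_big; apply: eq_bigr => j _ /=.
rewrite (bigD1_seq (x i)) ?undup_uniq ?mem_undup ?codom_f//= eqxx big1.
  by rewrite subr_eq0 (eq_sym (x i)) addr0 mulr1 mulrA.
by move=> z zi; rewrite (eq_sym (x i)) (negbTE zi) mulr0 mul0r.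
Qed.

(* [c * c~] for the finitely supported measure [c =
   \sum_k c k * \delta_(x k)]. *)
Definition autocorr (I : finType) (c : I -> R) (x : I -> G) : G -> R :=
  fun g => \sum_k \sum_l c k * c l * (g == x k - x l)%:R.

(** The form at [d], [y] is that of the delta function at 0, taken at the points [y j - x k] with
    coefficients [d j * c k]. *)
Lemma real_pd_autocorr (I : finType) (c : I -> R) (x : I -> G) :
  real_pd (autocorr c x).
Proof.
split=> [g|J d y]; rewrite /autocorr.
  rewrite exchange_big; apply: eq_bigr => k _; apply: eq_bigr => l _.
  by rewrite eqr_oppLR opprB (mulrC (c l)).
have := real_pd_delta.2 (J * I)%type (fun p => d p.1 * c p.2)
  (fun p => y p.1 - x p.2).
rewrite -(pair_bigA _ (fun j k => \sum_q (d j * c k * (d q.1 * c q.2) *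
  (y j - x k - (y q.1 - x q.2) == 0)%:R))) /=; congr (_ <= _).
apply: eq_bigr => i _.
under eq_bigr => k _ do
  rewrite -(pair_bigA _ (fun j l => d i * c k * (d j * c l) *
    (y i - x k - (y j - x l) == 0)%:R)).
rewrite exchange_big; apply: eq_bigr => j _ /=.
rewrite mulr_sumr; apply: eq_bigr => k _.
rewrite mulr_sumr; apply: eq_bigr => l _.
rewrite (_ : (_ == 0) = (y i - y j == x k - x l)).
  by rewrite mulrACA -[LHS]mulrA.
rewrite -[RHS]subr_eq0; congr (_ == _).
by rewrite !opprB [LHS]addrACA [RHS]addrACA (addrC (- x k)).
Qed.

(* Test [f] against autocorrelations. *)
Lemma real_pd_of_dual (S : {fset G}) f : even_function f ->
  (forall g, g \notin S -> f g = 0) ->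
  (forall nu, real_pd nu -> 0 <= \sum_(g <- S) f g * nu g) -> real_pd f.
Proof.
move=> fe f0 fdual; split=> // I c x.
have := fdual _ (real_pd_autocorr c x); congr (_ <= _).
under eq_bigr do rewrite mulr_sumr.
rewrite exchange_big; apply: eq_bigr => k _.
under eq_bigr do rewrite mulr_sumr.
rewrite exchange_big; apply: eq_bigr => l _ /=.
have [xS|xS] := boolP (x k - x l \in S).
  rewrite (big_fsetD1 _ xS) /= eqxx big_seq big1 ?addr0 ?mulr1 1?mulrC//.
  by move=> g; rewrite !inE => /andP[/negbTE -> _]; rewrite !mulr0.
rewrite f0// mulr0 big_seq big1// => g gS.
by case: eqP => [gE|_]; [rewrite -gE gS in xS|rewrite !mulr0].
Qed.

End PositiveDefinite.

(** * Folner sets and sums of positive definite functions *)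

Section Amenability.
Variables (G : zmodType) (R : realType).

Lemma sum_fset_translate (F : {fset G}) (t : G) (h : G -> R) :
  \sum_(x <- F) h (x + t) = \sum_(z <- [fset (x + t)%R | x in F]%fset) h z.
Proof. by rewrite big_imfset //= => ? ? _ _ /addIr. Qed.

Lemma bernoulli (x : R) (n : nat) : 0 <= x -> 1 + n%:R * x <= (1 + x) ^+ n.
Proof.
move=> x0; elim: n => [|n IHn]; first by rewrite expr0 mul0r addr0.
rewrite exprS; apply: (@le_trans _ _ ((1 + x) * (1 + n%:R * x))).
  rewrite -natr1; have : 0 <= n%:R * x ^+ 2 by rewrite mulr_ge0// sqr_ge0.
  by lra.
by rewrite ler_wpM2l// addr_ge0.
Qed.

(** Otherwise [a n] would be at least [(1 + e) ^+ n], which outgrows [n.+1 ^ d]. *)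
Lemma polynomial_growth_ratio (a : nat -> nat) (d : nat) (e : R) : 0 < e ->
  (forall n, 0 < a n <= n.+1 ^ d)%N ->
  exists n, (a n.+1)%:R <= (1 + e) * (a n)%:R :> R.
Proof.
move=> e0 ha; apply/not_existsP => hN.
have lt_a n : (1 + e) ^+ n <= (a n)%:R.
  elim: n => [|n IHn]; first by rewrite expr0 ler1n; case/andP: (ha 0%N).
  have /negP := hN n; rewrite -ltNge => /ltW; apply: le_trans.
  by rewrite exprS ler_wpM2l// addr_ge0// ltW.
(* At [n = m * d.+1] one has [(1 + e) ^+ m >= m e] and [n.+1 <= m * d.+2]; [C < m] says exactly that
   [(m e) ^+ d.+1] exceeds [(m * d.+2) ^+ d]. *)
pose C : R := d.+2%:R ^+ d / e ^+ d.+1.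
have C0 : 0 <= C by rewrite divr_ge0 ?exprn_ge0// ltW.
pose m := (Num.bound C).+1; pose n := (m * d.+1)%N.
have Cm : C < m%:R by rewrite (lt_trans (archi_boundP C0))// ltr_nat.
have an : (a n)%:R <= (m * d.+2)%:R ^+ d :> R.
  apply: (@le_trans _ _ (n.+1%:R ^+ d)).
    by rewrite -natrX ler_nat; case/andP: (ha n).
  by rewrite lerXn2r ?nnegrE// ler_nat /n /m; nia.
have := le_trans (lt_a n) an; apply/negP; rewrite -ltNge exprM.
apply: (@lt_le_trans _ _ ((m%:R * e) ^+ d.+1)); last first.
  have e1 := ltW e0; apply: lerXn2r; rewrite ?nnegrE.
  - by rewrite mulr_ge0.
  - by rewrite exprn_ge0// addr_ge0.
  - by apply: le_trans (bernoulli m e1); rewrite lerDr.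
rewrite natrM !exprMn exprSr -mulrA ltr_pM2l ?exprn_gt0 ?ltr0n//.
by rewrite -ltr_pdivrMr ?exprn_gt0.
Qed.


(** Translating [F N] by an element of [S] stays inside [F N.+1], so the boundary has at most
    [#|F N.+1| - #|F N|] points. Membership of 0 records that the set is nonempty. *)
Lemma folner (S : {fset G}) (e : R) : 0 < e ->
  exists F : {fset G}, 0 \in F /\ forall g, g \in S ->
    \sum_(y <- F) (y + g \notin F)%:R <= e * \sum_(y <- F) 1.
Proof.
move=> e0; pose d := size S.
pose p N (m : {ffun 'I_d -> 'I_N.+1}) : G := \sum_(i < d) S`_i *+ m i.
pose F N := [fset g in codom (@p N)]%fset.
have FP N g : reflect (exists m : 'I_d -> nat,
    (forall i, m i <= N)%N /\ g = \sum_(i < d) S`_i *+ m i) (g \in F N).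
  rewrite !inE; apply: (iffP codomP) => [[m ->]|[m [mN ->]]].
    by exists (fun i => m i : nat); split=> // i; rewrite -ltnS.
  exists [ffun i => inord (m i)]; rewrite /p; apply: eq_bigr => i _.
  by rewrite ffunE inordK// ltnS.
have F0 N : 0 \in F N.
  by apply/FP; exists (fun=> 0%N); split=> //; rewrite big1.
have FS N : (F N `<=` F N.+1)%fset.
  apply/fsubsetP => g /FP[m [mN ->]]; apply/FP; exists m; split=> // i.
  exact: leqW.
have Fadd N y g : y \in F N -> g \in S -> y + g \in F N.+1.
  move=> /FP[m [mN ->]] gS.
  have jd : (index g S < d)%N by rewrite index_mem.
  apply/FP; exists (fun i => m i + (i == Ordinal jd))%N; split=> [i|].
    by rewrite -addn1 leq_add// leq_b1.
  under [RHS]eq_bigr do rewrite mulrnDr.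
  rewrite big_split /=; congr (_ + _).
  rewrite (bigD1 (Ordinal jd))//= eqxx mulr1n nth_index// big1 ?addr0// => i.
  by move=> /negbTE ->; rewrite mulr0n.
have sum1E (A : {fset G}) : \sum_(y <- A) 1 = #|` A|%:R :> R.
  by rewrite big_const_seq count_predT iter_addr_0.
have cardF N : (0 < #|` F N| <= N.+1 ^ d)%N.
  apply/andP; split; first by rewrite cardfs_gt0; apply/fset0Pn; exists 0.
  rewrite card_fseq (leq_trans (size_undup _))// size_codom card_ffun.
  by rewrite !card_ord.
have [N FN] := polynomial_growth_ratio e0 cardF.
exists (F N); split=> // g gS; rewrite sum1E.
rewrite (sum_fset_translate _ _ (fun z => (z \notin F N)%:R)).
apply: (@le_trans _ _ (\sum_(z <- F N.+1) (z \notin F N)%:R)).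
  apply: ler_sum_fset => //; apply/fsubsetP => _ /imfsetP[y yF ->].
  exact: Fadd.
suff -> : \sum_(z <- F N.+1) (z \notin F N)%:R =
    #|` F N.+1|%:R - #|` F N|%:R :> R.
  lra.
rewrite -!sum1E !(sum_fsetID _ (FS N)) [X in X + _ = _]big_seq.
rewrite [X in X + _ = _]big1 ?add0r; last by move=> z ->.
rewrite addrAC subrr add0r big_seq [RHS]big_seq; apply: eq_bigr => z.
by rewrite inE => /andP[->].
Qed.

Lemma real_pd_sum_ge0 (h : G -> R) (l m : R) : real_pd h -> has_sum h l ->
  has_sum (fun g => `|h g|) m -> 0 <= l.
Proof.
move=> [_ hpd] hl habs; apply/ler_addgt0Pr => e e0.
have e3 : 0 < e / 3 by lra.
have [A hA] := hl _ e3.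
have [B hB] := has_sum_tail habs (fun g => normr_ge0 (h g)) e3.
pose S := (A `|` B)%fset; pose M := \sum_(g <- S) `|h g|.
have M0 : 0 <= M by exact: sumr_ge0.
(* With this Folner constant the boundary terms, weighted by [|h|] on [S], cost at most [e / 3] per
   point of [F]. The other two thirds pay for the tail outside [S] and for the distance from the sum
   over [S] to [l]. *)
have e1 : 0 < e / 3 / (M + 1) by rewrite divr_gt0// ltr_wpDl.
have [F [F0 hF]] := folner S e1.
pose Fy y := [fset x - y | x in F]%fset.
have FyP y g : (g \in Fy y) = (y + g \in F).
  apply/imfsetP/idP => [[x xF ->]|ygF]; first by rewrite addrC subrK.
  by exists (y + g) => //; rewrite addrAC subrr add0r.
have := hpd F (fun=> 1) (fun y => val y).
under eq_bigr do (under eq_bigr do rewrite !mul1r).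
rewrite exchange_big /= -(big_seq_fsetE _ _ predT
  (fun y => \sum_(x : F) h (val x - y))) /=.
(* The translate [Fy y] is compared with [S]: its points outside [S] lie in the tail, and the points
   of [S] that it misses are boundary terms. *)
have sumFy y : \sum_(x : F) h (val x - y) <=
    \sum_(g <- S) h g + \sum_(g <- S) `|h g| * (y + g \notin F)%:R + e / 3.
  rewrite -(big_seq_fsetE _ _ predT (fun x => h (x - y))) sum_fset_translate /=.
  rewrite -/(Fy y) (sum_fsetID _ (fsubsetIl (Fy y) S)) fsetDIr fsetDv fset0U.
  rewrite [in leRHS](sum_fsetID _ (fsubsetIr (Fy y) S)) fsetDIr fsetDv fsetU0.
  have t1 : \sum_(g <- (Fy y `\` S)%fset) h g <= e / 3.
    apply: (@le_trans _ _ (\sum_(g <- (Fy y `\` S)%fset) `|h g|)).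
      by apply: ler_sum => g _; exact: ler_norm.
    by apply: hB; rewrite fdisjoint_sym; apply/fdisjointP => g; rewrite !inE; lia.
  have t2 : \sum_(g <- (S `\` Fy y)%fset) - h g <=
      \sum_(g <- S) `|h g| * (y + g \notin F)%:R.
    have := @ler_sum_fset _ _ _ _ (fun g => `|h g| * (y + g \notin F)%:R)
      (fsubsetDl S (Fy y)).
    move=> /(_ (fun g => mulr_ge0 (normr_ge0 _) (ler0n _ _))); apply: le_trans.
    rewrite big_seq [leRHS]big_seq; apply: ler_sum => g.
    by rewrite inE FyP => /andP[-> _]; rewrite mulr1 -normrN ler_norm.
  by move: t2; rewrite sumrN; lra.
set K := \sum_(y <- F) (1 : R) in hF.
have sumK (c : R) : \sum_(y <- F) c = c * K.
  by rewrite mulr_sumr; apply: eq_bigr => ? _; rewrite mulr1.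
have K0 : 0 < K.
  rewrite /K (big_fsetD1 0)//= (lt_le_trans ltr01)// lerDl.
  by rewrite sumr_ge0.
have tF : \sum_(y <- F) \sum_(g <- S) `|h g| * (y + g \notin F)%:R <= K * (e / 3).
  rewrite exchange_big /=.
  apply: (@le_trans _ _ (\sum_(g <- S) `|h g| * (e / 3 / (M + 1) * K))).
    rewrite big_seq [leRHS]big_seq; apply: ler_sum => g gS.
    by rewrite -mulr_sumr ler_wpM2l// hF.
  rewrite -mulr_suml -/M (mulrC K) mulrA ler_wpM2r ?(ltW K0)//.
  rewrite mulrCA ler_piMr ?(ltW e3)// ler_pdivrMr ?ltr_wpDl//.
  by rewrite mul1r lerDl.
move=> sum0; have := le_trans sum0 (ler_sum _ (fun y _ => sumFy y)).
rewrite !big_split /= !sumK => sumS.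
have : 0 <= (\sum_(g <- S) h g + e / 3 + e / 3) * K by lra.
rewrite pmulr_lge0// => S0.
by have := hA S (fsubsetUl _ _); rewrite ler_norml; lra.
Qed.

Lemma pairing_pd_ge0 (f nu : G -> R) : l1 f -> real_pd f -> real_pd nu ->
  0 <= pairing f nu.
Proof.
move=> fl fpd nupd.
have nul : linfty nu by exact: bound_linfty (fun g => real_pd_le g nupd).
have [m hm] := abs_has_sum fl nul.
exact: real_pd_sum_ge0 (real_pdM fpd nupd) (pairing_has_sum fl nul) hm.
Qed.

End Amenability.

(** * Compactness, and minimisation over positive definite functions *)

Section Krein.
Variables (G : zmodType) (R : realType).
Implicit Types (f nu mu : G -> R).

Local Notation ptw := (prod_topology (fun _ : G => R)).

Lemma eval_continuous (g : G) : continuous (fun nu : ptw => nu g : R).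
Proof. exact: (@proj_continuous G (fun _ => R) g). Qed.

Lemma sum_continuous (T : topologicalType) (I : Type) (r : seq I)
    (F : I -> T -> R) : (forall i, continuous (F i)) ->
  continuous (fun x => \sum_(i <- r) F i x).
Proof. by move=> cF; apply: continuous_big => //; exact: add_continuous. Qed.

Lemma closure_ge0 (T : topologicalType) (A : set T) (L : T -> R) (x : T) :
  continuous L -> (forall a, A a -> 0 <= L a) -> closure A x -> 0 <= L x.
Proof.
move=> cL LA clx.
have clL : closed (L @^-1` [set y | 0 <= y]).
  by move/continuous_closedP: cL; apply; exact: closed_ge.
exact: clL (closure_subset LA clx).
Qed.

(** The finite intersections generate a proper filter on [K], and a cluster point of it lies in
    every closed [C i]. *)
Lemma compact_fip (T : topologicalType) (I : choiceType) (K : set T)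
    (C : I -> set T) : compact K -> (forall i, closed (C i)) ->
  (forall D : {fset I}, exists2 x, K x & forall i, i \in D -> C i x) ->
  exists2 x, K x & forall i, C i x.
Proof.
move=> cK cC fip.
pose B (D : {fset I}) := K `&` [set x | forall i, i \in D -> C i x].
have FF : ProperFilter (filter_from setT B).
  apply: filter_from_proper => [|D _]; last by have [x ? ?] := fip D; exists x.
  apply: filter_from_filter; first by exists fset0.
  move=> D E _ _; exists (D `|` E)%fset => // x [Kx xDE].
  by split; split=> // i iDE; apply: xDE; rewrite inE iDE ?orbT.
have [|x [Kx clx]] := cK _ FF.
  by exists fset0 => // x [].
exists x => // i; apply: cC => U Ux.
have [|y [[_ yC] Uy]] := clx (B [fset i]%fset) U _ Ux.
  by exists [fset i]%fset.
by exists y; split=> //; apply: yC; rewrite inE.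
Qed.

Definition pd_ball (M : R) : set ptw := [set nu : ptw | real_pd nu /\ nu 0 <= M].

Lemma pd_ball_compact (M : R) : compact (pd_ball M).
Proof.
apply: (@subclosed_compact _ _
  [set nu : ptw | forall g, `[-M, M]%classic (nu g)]).
- move=> nu clnu.
  have ge0_of (L : ptw -> R) : continuous L ->
      (forall a : ptw, real_pd a -> a 0 <= M -> 0 <= L a) -> 0 <= L nu.
    by move=> cL LA; apply: (closure_ge0 cL _ clnu) => a [? ?]; exact: LA.
  have evB (g h : G) : continuous (fun a : ptw => a g - a h : R).
    move=> a.
    exact: cvgB (@eval_continuous g a) (@eval_continuous h a).
  split; [split=> [g|I c x]|].
  (* Only inequalities pass through [closure_ge0], so evenness is split into two. *)
  + have h1 : 0 <= nu (- g) - nu g.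
      by apply: (ge0_of _ (evB (- g) g)) => a [ae _] _; rewrite ae subrr.
    have h2 : 0 <= nu g - nu (- g).
      by apply: (ge0_of _ (evB g (- g))) => a [ae _] _; rewrite ae subrr.
    by lra.
  + apply: (ge0_of (fun a : ptw => \sum_i \sum_j c i * c j * a (x i - x j))).
      apply: sum_continuous => i; apply: sum_continuous => j a.
      exact: cvgM (cvg_cst _) (@eval_continuous (x i - x j) a).
    by move=> a [_ +] _; exact.
  + rewrite -subr_ge0; apply: (ge0_of (fun a : ptw => M - a 0)).
      move=> a; exact: cvgB (cvg_cst M) (@eval_continuous 0 a).
    by move=> a _ aM; rewrite subr_ge0.
- exact: (@tychonoff G (fun=> R) (fun=> `[-M, M]%classic)
    (fun=> @segment_compact R (- M) M)).
- move=> nu [nupd nuM] g /=; rewrite in_itv /= -ler_norml.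
  exact: le_trans (real_pd_le g nupd) nuM.
Qed.

Lemma linear_coef_ge0 (a C : R) : 0 <= C ->
  (forall t, 0 < t -> t <= 1 -> 0 <= t * a *+ 2 + t ^+ 2 * C) -> 0 <= a.
Proof.
move=> C0 ht; rewrite leNgt; apply/negP => a0.
have d0 : 0 < C + 1 - a by lra.
(* For this [t], [a *+ 2 + t * C] equals [a - t * (1 - a)], which is negative. *)
have t0 : 0 < - a / (C + 1 - a) by rewrite divr_gt0// oppr_gt0.
have t1 : - a / (C + 1 - a) <= 1 by rewrite ler_pdivrMr//; lra.
have := ht _ t0 t1; set t := - a / _ in t0 *.
have -> : t * a *+ 2 + t ^+ 2 * C = t * (a *+ 2 + t * C) by ring.
rewrite pmulr_rge0// => h.
have tC : t * (C + 1 - a) = - a by rewrite divfK// gt_eqF.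
have : t * (1 - a) > 0 by rewrite mulr_gt0//; lra.
by lra.
Qed.

Section Residual.
Variables (Omega : set G) (mu : G -> R) (S : {fset G}).

(* [residual nu] is half the gradient of [defect] at [nu], and [defect nu] is
   the squared distance, on [S], from [nu] to the set of functions that equal
   [mu] on [Omega] and are at least [mu] off [Omega]. *)
Definition residual nu g : R :=
  if g \in Omega then nu g - mu g else Num.min (nu g - mu g) 0.

Definition defect nu : R := \sum_(g <- S) residual nu g ^+ 2.

Lemma residual_continuous g : continuous (fun nu : ptw => residual nu g : R).
Proof.
have cB : continuous (fun nu : ptw => nu g - mu g : R).
  move=> nu; exact: cvgB (@eval_continuous g nu) (cvg_cst (mu g)).
have cmin : continuous (fun a : R => Num.min a 0).
  move=> a; apply: (@continuous_min R R idfun (cst 0)); first exact: cvg_id.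
  exact: cvg_cst.
rewrite /residual; case: (g \in Omega) => // nu.
exact: (@continuous_comp ptw R R _ _ nu (cB nu) (cmin _)).
Qed.

Lemma defect_continuous : continuous (defect : ptw -> R).
Proof.
apply: sum_continuous => g nu.
exact: cvgM (@residual_continuous g nu) (@residual_continuous g nu).
Qed.

(** Off [Omega], with [a = nu g - mu g], the new residual is up to sign the distance from
    [a + t * eta g] to the half-line of nonnegative reals. It is at most the distance to [max a 0],
    the point nearest to [a]. *)
Lemma residual_perturb nu eta g (t : R) :
  residual (fun g => nu g + t * eta g) g ^+ 2 <=
  (residual nu g + t * eta g) ^+ 2.
Proof.
rewrite /residual; case: ifP => _; first by rewrite addrAC.
set b := t * _; rewrite addrAC; set a := nu g - mu g.
rewrite /Num.min; case: ltP => ab; case: ltP => a0 //.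
- by rewrite add0r; nra.
- by rewrite expr0n/= sqr_ge0.
- by rewrite expr0n/= sqr_ge0.
Qed.

Lemma defect_perturb nu eta (t : R) :
  defect (fun g => nu g + t * eta g) <=
  defect nu + t * (\sum_(g <- S) residual nu g * eta g) *+ 2 +
    t ^+ 2 * \sum_(g <- S) eta g ^+ 2.
Proof.
apply: le_trans (ler_sum _ (fun g _ => residual_perturb nu eta g t)) _.
rewrite mulr_sumr -sumrMnl mulr_sumr -!big_split /=.
by apply: ler_sum => g _; rewrite le_eqVlt; apply/orP; left; apply/eqP; ring.
Qed.

(** At each point the residual is [nu g - mu g] or 0, so its product with [nu g - mu g] is its
    square. *)
Lemma sum_residual_mu nu :
  \sum_(g <- S) residual nu g * mu g =
  \sum_(g <- S) residual nu g * nu g - defect nu.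
Proof.
rewrite -sumrB; apply: eq_bigr => g _; rewrite /residual.
case: ifP => _; first by ring.
by rewrite /Num.min; case: ltP => _; ring.
Qed.

Lemma defect_minimizer : 0 \in S -> Omega 0 ->
  exists2 nu, real_pd nu & forall eta, real_pd eta -> defect nu <= defect eta.
Proof.
move=> S0 Om0; pose M := `|mu 0| + defect (fun=> 0) + 1.
have d0 : 0 <= defect (fun=> 0) by apply: sumr_ge0 => g _; exact: sqr_ge0.
have B0 : pd_ball M (fun=> 0).
  by split; [exact: real_pd0|rewrite /M !addr_ge0].
have [|nu /set_mem [nupd _] nu_min] := @compact_EVT_min ptw R defect (pd_ball M) _
    (@pd_ball_compact M) (continuous_subspaceT defect_continuous).
  by exists (fun=> 0).
exists nu => // eta etapd; have [etaM|] := leP (eta 0) M.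
  by apply: nu_min; rewrite inE.
move=> etaM; apply: (@le_trans _ _ (defect (fun=> 0))).
  by apply: nu_min; rewrite inE.
apply: (@le_trans _ _ ((eta 0 - mu 0) ^+ 2)).
  have : defect (fun=> 0) + 1 <= eta 0 - mu 0.
    by have := ler_norm (mu 0); rewrite /M in etaM; lra.
  by nra.
rewrite /defect (big_fsetD1 0)//= {1}/residual mem_set// lerDl.
by apply: sumr_ge0 => g _; exact: sqr_ge0.
Qed.

End Residual.

End Krein.

(** * The dual of the primal cone *)

Section DualCone.
Variables (G : zmodType) (R : realType) (Omega : set G).
Hypotheses (Omega_sym : Omega = [set - g | g in Omega]) (Omega0 : Omega 0).
Implicit Types (f nu mu : G -> R).

Lemma Omega_opp g : (- g \in Omega) = (g \in Omega).
Proof.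
have opp h : Omega h -> Omega (- h).
  by rewrite [in X in _ -> X]Omega_sym; exists h.
by apply/idP/idP => /[!inE] /opp; rewrite ?opprK.
Qed.

Lemma residual_even mu nu : even_function mu -> even_function nu ->
  even_function (residual Omega mu nu).
Proof. by move=> mue nue g; rewrite /residual Omega_opp mue nue. Qed.

Lemma pd_majorant_fset mu (T : {fset G}) : even_function mu ->
  dual_cone (primal_cone Omega) mu -> 0 \in T ->
  exists2 nu, real_pd nu &
    forall g, g \in T -> (Omega g -> nu g = mu g) /\ mu g <= nu g.
Proof.
move=> mue [mul mudual] T0.
(* Symmetrised so that the residual cut off outside [S] remains even. *)
pose S := (T `|` [fset (- g)%R | g in T])%fset.
have ST g : g \in T -> g \in S by move=> gT; rewrite inE gT.
have SN g : (- g \in S) = (g \in S).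
  have opp h : h \in S -> - h \in S.
    rewrite !in_fsetU => /orP[hT|/imfsetP[k kT ->]].
      by apply/orP; right; apply/imfsetP; exists h.
    by rewrite opprK kT.
  by apply/idP/idP => /opp; rewrite ?opprK.
have S0 : 0 \in S by exact: ST.
have [nu nupd nu_min] := defect_minimizer mu S0 Omega0.
pose r := residual Omega mu nu.
pose f g := if g \in S then r g else 0.
have fS h : \sum_(g <- S) f g * h g = \sum_(g <- S) r g * h g.
  by rewrite big_seq [RHS]big_seq; apply: eq_bigr => g; rewrite /f => ->.
(* First-order optimality of [nu] in each direction that stays in the cone of positive definite
   functions for small steps. *)
have grad eta : (forall t : R, 0 < t -> t <= 1 ->
    real_pd (fun g => nu g + t * eta g)) -> 0 <= \sum_(g <- S) r g * eta g.
  move=> etapd; apply: (@linear_coef_ge0 _ _ (\sum_(g <- S) eta g ^+ 2)).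
    by apply: sumr_ge0 => g _; exact: sqr_ge0.
  move=> t t0 t1; have := nu_min _ (etapd t t0 t1).
  by have := defect_perturb Omega mu S nu eta t; rewrite -/r; lra.
have fpd : real_pd f.
  apply: (@real_pd_of_dual _ _ S).
  - by move=> g; rewrite /f SN /r (residual_even mue nupd.1).
  - by move=> g; rewrite /f => /negbTE ->.
  - move=> eta etapd; rewrite fS; apply: grad => t t0 _.
    by apply: real_pdD => //; apply: real_pdZ => //; exact: ltW.
have f0 g : g \notin S -> f g = 0 by rewrite /f => /negbTE ->.
have fl : l1 f := l1_fset f0.
have fK : primal_cone Omega f.
  split=> //; first exact/rpositive_definiteP.
  move=> g /= Og; rewrite /f; case: ifP => // _; rewrite /r /residual.
  by rewrite memNset// ge_min lexx orbT.
have pE : pairing f mu = \sum_(g <- S) r g * mu g.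
  rewrite -fS; apply: has_sum_unique (pairing_has_sum fl mul) _.
  by apply: has_sum_fset => g /f0 ->; rewrite mul0r.
(* The direction [- nu] is admissible because [(1 - t) * nu] is positive definite for [t <= 1]. *)
have nu_r : \sum_(g <- S) r g * nu g <= 0.
  rewrite -oppr_ge0 -sumrN; under eq_bigr do rewrite -mulrN.
  apply: grad => t t0 t1; rewrite (_ : (fun _ => _) = fun g => (1 - t) * nu g).
    by apply: real_pdZ => //; rewrite subr_ge0.
  by apply/funext => g; ring.
have dE : defect Omega mu S nu = 0.
  apply/eqP; rewrite eq_le; apply/andP; split; last first.
    by apply: sumr_ge0 => g _; exact: sqr_ge0.
  have := mudual _ fK; rewrite pE sum_residual_mu -/r; lra.
exists nu => // g /ST gS.
have : r g = 0.
  apply/eqP; rewrite -sqrf_eq0 eq_le sqr_ge0 andbT -dE /defect.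
  rewrite (big_fsetD1 g)//= lerDl.
  by apply: sumr_ge0 => h _; exact: sqr_ge0.
rewrite /r /residual; case: ifPn => [gO|/negP gO].
  by move=> /subr0_eq ->.
rewrite inE in gO; rewrite /Num.min; case: ltP => //.
  by move=> + E; rewrite E ltxx.
by rewrite subr_ge0.
Qed.

Lemma pd_majorant mu : even_function mu -> dual_cone (primal_cone Omega) mu ->
  exists2 nu, real_pd nu & forall g, (Omega g -> nu g = mu g) /\ mu g <= nu g.
Proof.
move=> mue mudual.
pose C (g : G) := [set nu : prod_topology (fun _ : G => R) |
  (Omega g -> nu g = mu g) /\ mu g <= nu g].
have cC g : closed (C g).
  have /continuous_closedP cg := @eval_continuous G R g.
  have -> : C g = (fun nu : prod_topology (fun _ : G => R) => nu g) @^-1`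
      [set x : R | Omega g -> x = mu g] `&`
    (fun nu : prod_topology (fun _ : G => R) => nu g) @^-1` [set x | mu g <= x].
    by apply/seteqP; split=> nu [].
  apply: closedI; apply: cg; last exact: closed_ge.
  have [Og|nOg] := pselect (Omega g).
    rewrite (_ : [set _ | _] = [set x | x = mu g]); first exact: closed_eq.
    by apply/seteqP; split=> x /=; [exact|].
  rewrite (_ : [set _ | _] = setT); first exact: closedT.
  by apply/seteqP; split=> x //= _ /nOg.
have [T|nu [nupd _] nuC] := compact_fip (@pd_ball_compact G R (mu 0)) cC.
  (* Adjoining 0, a point of [Omega], forces [nu 0 = mu 0], so all finite majorants lie in one
     compact ball. *)
  have T0 := fset1U1 0 T; have [nu nupd nuT] := pd_majorant_fset mue mudual T0.
  exists nu => [|g gT]; last by apply: nuT; rewrite inE gT orbT.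
  have [/(_ Omega0) nu0 _] := nuT 0 T0.
  by split=> //; rewrite nu0.
by exists nu.
Qed.

(** Functions of the primal cone are even and so test only the even part of [mu]; evenness is
    therefore assumed. For the converse, [- f * kappa >= 0] everywhere gives
    [<f, mu> >= <f, nu> >= 0]. *)
Lemma dual_cone_primal_cone mu : even_function mu ->
  dual_cone (primal_cone Omega) mu <-> M_class (~` Omega) mu.
Proof.
move=> mue; split=> [mudual|[mul [nu [kappa [muE kappa0 kappaO nupd]]]]].
  split; first by case: mudual.
  have [nu nupd nuP] := pd_majorant mue mudual.
  exists nu, (nu \- mu); split.
  - by apply/funext => g /=; rewrite opprB addrC subrK.
  - by move=> g; rewrite subr_ge0; case: (nuP g).
  - move=> g; rewrite setCK => Og; have [/(_ Og) + _] := nuP g.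
    by rewrite /= => ->; rewrite subrr.
  - exact/rpositive_definiteP.
move/rpositive_definiteP in nupd.
split=> // f [fl /rpositive_definiteP fpd fO].
have nul : linfty nu := bound_linfty (fun g => real_pd_le g nupd).
have := pairing_pd_ge0 fl fpd nupd.
have : 0 <= pairing f mu - pairing f nu; last by lra.
apply: has_sum_ge0 (has_sumB (pairing_has_sum fl mul) (pairing_has_sum fl nul)).
move=> g; rewrite /= muE /= -mulrBr addrAC subrr add0r.
have [Og|nOg] := pselect (Omega g).
  by rewrite kappaO ?oppr0 ?mulr0// setCK.
by rewrite mulrN -mulNr mulr_ge0// oppr_ge0 fO.
Qed.

End DualCone.

(** * Identification of the dual program and absence of a gap *)

Theorem theorem1p2 (R : realType) (G : zmodType) (Omega : set G)
    (Omega_sym : Omega = [set - g | g in Omega]) (Omega0 : Omega 0)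
    (rho sigma : G -> R)
    (rho_bounded : linfty rho) (sigma_bounded : linfty sigma)
    (sigma_spd : strictly_positive_definite sigma)
    (rho_even : even_function rho) :
  [/\ F_class sigma Omega = lp_feasible (primal_cone Omega) sigma,
      dual_lp_feasible (primal_cone Omega) rho sigma =
        [set s : R | M_class (~` Omega) (fun g => rho g - s * sigma g)] &
      alpha rho sigma Omega = omega rho sigma (~` Omega)].
Proof.
have [_ /rpositive_definite_even sigma_even sigma_pos] := sigma_spd.
have evenB s : even_function (fun g => rho g - s * sigma g).
  by move=> g; rewrite rho_even sigma_even.
have dualE : dual_lp_feasible (primal_cone Omega) rho sigma =
    [set s : R | M_class (~` Omega) (fun g => rho g - s * sigma g)].
  by apply/funext => s; apply/propext; exact: dual_cone_primal_cone.
split=> //.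
  by apply/funext => f; apply/propext; split=> [[]|[[]]].
rewrite /omega -dualE; apply/eqP; rewrite eq_le; apply/andP; split; last first.
  (* Weak duality: [0 <= <f, rho - s sigma> = <f, rho> - s] for feasible [f] and [s]. *)
  apply: ge_ereal_sup => _ [s [_ sdual] <-].
  apply: le_ereal_inf_tmp => _ [f [fl fpd fO f1] <-].
  have := sdual f (And3 fl fpd fO).
  by rewrite pairingB// f1 mulr1 subr_ge0 lee_fin.
have dual_of_le s : (s%:E <= alpha rho sigma Omega)%E ->
    dual_lp_feasible (primal_cone Omega) rho sigma s.
  move=> s_le; have rsl := linftyB s rho_bounded sigma_bounded.
  split=> // f [fl fpd fO].
  have [->|f0] := pselect (f = cst 0); first by rewrite pairing0l.
  rewrite pairingB//.
  have fs := sigma_pos f fl fpd f0.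
  set a := (pairing f sigma)^-1; have a0 : 0 < a by rewrite invr_gt0.
  have afF : F_class sigma Omega (fun g => a * f g).
    split; first exact: l1Z.
    - apply/rpositive_definiteP/real_pdZ; first exact: ltW.
      exact/rpositive_definiteP.
    - by move=> g /fO; rewrite pmulr_rle0.
    - by rewrite pairingZl// mulVf// gt_eqF.
  have : (s%:E <= (pairing (fun g => a * f g) rho)%:E)%E.
    apply: le_trans s_le _; apply: ereal_inf_lbound.
    by exists (fun g => a * f g).
  by rewrite lee_fin pairingZl// mulrC ler_pdivlMr// subr_ge0.
case E : (alpha rho sigma Omega) => [a| |]; last by rewrite leNye.
  by apply: ereal_sup_ubound; exists a => //; apply: dual_of_le; rewrite E.
(* Here [alpha] is [+oo], so every real [s] is dual feasible. *)
rewrite leye_eq; apply/eqP/eqyP => s _.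
by apply: ereal_sup_ubound; exists s => //; apply: dual_of_le; rewrite E leey.
Qed.
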